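(* Let $\pi$ be a canonical element of a $\mathbb{Z}^n$-graded Lie algebra $(V,\{-,-\})$. If $H_\pi^{\deg(\pi)}(V)=0$, then any formal deformation of $\pi$ is trivial.
   Context: All vector spaces are over a field $\mathbb{K}$ of characteristic $0$. For $\alpha,\beta\in\mathbb{Z}^n$ ($n\ge 1$), $\langle\alpha,\beta\rangle=\sum_i\alpha_i\beta_i$. A $\mathbb{Z}^n$-graded Lie algebra is a $\mathbb{Z}^n$-graded vector space $V=\bigoplus_{\alpha\in\mathbb{Z}^n} V^\alpha$ with a bilinear bracket of weight $0$ such that $\{a,b\}=-(-1)^{\langle a,b\rangle}\{b,a\}$ and $\{a,\{b,c\}\}=\{\{a,b\},c\}+(-1)^{\langle a,b\rangle}\{b,\{a,c\}\}$ for homogeneous $a,b,c$ (in exponents, a homogeneous element stands for its degree). A homogeneous element $w$ is odd if $\langle w,w\rangle$ is odd. A canonical element is an odd element $\pi\in V$ with $\{\pi,\pi\}=0$; then $\partial_\pi:=\{\pi,-\}$ squares to zero, and $H^\alpha_\pi(V)=\ker(\partial_\pi|_{V^\alpha})/\partial_\pi(V^{\alpha-\deg\pi})$. $V[[\nu]]=\bigoplus_{\alpha}V^\alpha[[\nu]]$, with $V^\alpha[[\nu]]$ the formal power series in $\nu$ with coefficients in $V^\alpha$; the bracket is extended naturally. A formal deformation of $\pi$ is a series $\pi_\nu=\sum_{i\ge 0}\nu^i\pi_i\in V^{\deg(\pi)}[[\nu]]$ with $\pi_0=\pi$ and $\{\pi_\nu,\pi_\nu\}=0$. Two formal deformations $\pi_\nu,\pi'_\nu$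 of $\pi$ are equivalent if there is a series $\chi_\nu=\sum_{i\ge1}\nu^i\chi_i\in V^0[[\nu]]$ with $\exp(\mathrm{ad}\,\chi_\nu)\pi_\nu=\pi'_\nu$, where $\mathrm{ad}\,\chi_\nu=\{\chi_\nu,-\}$ and $\exp$ is the exponential series. A formal deformation is trivial if it is equivalent to $\pi$. *)

(* Defs.v *)
From HB Require Import structures.
From mathcomp Require Import all_boot all_order all_algebra.
From mathcomp Require Import ring_quotient.
From mathcomp Require Import mathcomp_extra boolp classical_sets functions.

Set Implicit Arguments.
Unset Strict Implicit.
Unset Printing Implicit Defensive.

Import GRing.Theory.

Local Open Scope ring_scope.

Definition dot n (a b : 'rV[int]_n) : int := \sum_(i < n) a 0 i * b 0 i.

Definition odd_degree n (a : 'rV[int]_n) : bool := odd `|dot a a|%N.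

(* A grading is internal: [hcomp a] is the subspace V^a of V, and the two
   [hcomp_sum] axioms say that V is the direct sum of these subspaces. *)
HB.mixin Record Lmodule_isGradedLie (n : nat) (K : fieldType) V
    of GRing.Lmodule K V := {
  hcomp : 'rV[int]_n -> set V;
  hcomp0 : forall a, hcomp a 0;
  hcomp_linear : forall a (k : K) x y,
    hcomp a x -> hcomp a y -> hcomp a (k *: x + y);
  hcomp_sum_exists : forall x : V,
    exists (s : seq 'rV[int]_n) (f : 'rV[int]_n -> V),
      [/\ uniq s, forall a, hcomp a (f a) & x = \sum_(a <- s) f a];
  hcomp_sum_direct : forall (s : seq 'rV[int]_n) (f : 'rV[int]_n -> V),
    uniq s -> (forall a, hcomp a (f a)) -> \sum_(a <- s) f a = 0 ->
    forall a, a \in s -> f a = 0;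
  bracket : V -> V -> V;
  bracket_bilinear : bilinear_for *:%R *:%R bracket;
  bracket_hcomp : forall a b x y,
    hcomp a x -> hcomp b y -> hcomp (a + b) (bracket x y);
  bracket_antisym : forall a b x y, hcomp a x -> hcomp b y ->
    bracket x y = - ((-1 : K) ^ dot a b *: bracket y x);
  bracket_jacobi : forall a b c x y z, hcomp a x -> hcomp b y -> hcomp c z ->
    bracket x (bracket y z) =
    bracket (bracket x y) z + (-1 : K) ^ dot a b *: bracket y (bracket x z)
}.

#[short(type="gradedLieType")]
HB.structure Definition GradedLie (n : nat) (K : fieldType) :=
  {V of GRing.Lmodule K V & Lmodule_isGradedLie n K V}.

HB.instance Definition _ n (K : fieldType) (V : gradedLieType n K) :=
  bilinear_isBilinear.Build K V V V *:%R *:%R (@bracket n K V)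
    (@bracket_bilinear n K V).

(* The degree [d] is an explicit argument because 0 is homogeneous of every
   degree. *)
Definition canonical_element n (K : fieldType) (V : gradedLieType n K)
    (d : 'rV[int]_n) (p : V) : Prop :=
  [/\ hcomp d p, odd_degree d & bracket p p = 0].

Section Cohomology.
Variables (n : nat) (K : fieldType) (V : gradedLieType n K).
Variables (d : 'rV[int]_n) (p : V) (a : 'rV[int]_n).

Definition is_cocycle : {pred V} :=
  fun x => `[< hcomp a x /\ bracket p x = 0 >].

Lemma is_cocycle_submod : submod_closed is_cocycle.
Proof.
split=> [|k x y /asboolP[ax px] /asboolP[ay py]]; apply/asboolP.
  by split; [exact: hcomp0 | rewrite linear0r].
by split; [exact: hcomp_linear | rewrite linearPr /= px py scaler0 addr0].
Qed.

HB.instance Definition _ :=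
  GRing.isSubmodClosed.Build K V is_cocycle is_cocycle_submod.

Record cocycle := Cocycle {
  cocycle_val :> V;
  _ : cocycle_val \in is_cocycle
}.

HB.instance Definition _ := [isSub for cocycle_val].
HB.instance Definition _ := [Choice of cocycle by <:].
HB.instance Definition _ := [SubChoice_isSubZmodule of cocycle by <:].
HB.instance Definition _ := [SubZmodule_isSubLmodule of cocycle by <:].

Definition is_coboundary : {pred cocycle} :=
  fun z => `[< exists2 y : V, hcomp (a - d) y & bracket p y = val z >].

Lemma is_coboundary_zmod : zmod_closed is_coboundary.
Proof.
split=> [|u v /asboolP[x ax px] /asboolP[y ay py]]; apply/asboolP.
  by exists 0; [exact: hcomp0 | rewrite linear0r raddf0].
exists (x - y); last by rewrite raddfB linearBr /= px py.
by rewrite [x - y]addrC -[- y]scaleN1r; exact: hcomp_linear.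
Qed.

HB.instance Definition _ :=
  GRing.isZmodClosed.Build cocycle is_coboundary is_coboundary_zmod.

(* Only the additive group structure of the quotient is provided. *)
Definition cohomology : zmodType := Quotient.quot is_coboundary.

End Cohomology.

(* A formal power series in nu is the sequence of its coefficients; its linear
   structure is the pointwise one on functions. *)
Section FormalSeries.
Variables (n : nat) (K : fieldType) (V : gradedLieType n K).
Implicit Types (p : V) (f g chi : nat -> V) (d a : 'rV[int]_n).

Definition hseries a : set (nat -> V) := fun f => forall i, hcomp a (f i).

Definition const_series p : nat -> V := fun i => if i == 0%N then p else 0.

Definition sbracket f g : nat -> V :=
  fun m => \sum_(i < m.+1) bracket (f i) (g (m - i)%N).

Definition formal_deformation d p f : Prop :=
  [/\ hseries d f, f 0%N = p & sbracket f f = 0].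

(* [g] is the sum of the exponential series exp(ad chi) f for the nu-adic
   topology: each coefficient of the partial sums is eventually that of [g]. *)
Definition is_exp_ad chi f g : Prop :=
  forall m, exists N0 : nat, forall N, (N0 <= N)%N ->
    (\sum_(k < N) (k`!%:R^-1 : K) *: iter k (sbracket chi) f) m = g m.

Definition equivalent_deformations f g : Prop :=
  exists chi, [/\ hseries 0 chi, chi 0%N = 0 & is_exp_ad chi f g].

Definition trivial_deformation p f : Prop :=
  equivalent_deformations f (const_series p).

End FormalSeries.

(* Main.v *)
Require Import Defs.
From HB Require Import structures.
From mathcomp Require Import all_boot all_order all_algebra.
From mathcomp Require Import ring_quotient boolp functions.
From mathcomp Require Import zify.
Import GRing.Theory.
Local Open Scope ring_scope.

(** A deformation f of p is gauged to p one coefficient at a time, by building a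
single series chi rather than an infinite composition of exponentials; this
way the Baker-Campbell-Hausdorff formula never enters.

Since chi has no constant term, the coefficient of nu^m in exp(ad chi) f is a
finite expression in chi_1, ..., chi_m and f.  The last of these, chi_m, only
enters it through the linear term, as {chi_m, f_0} = {chi_m, p}
([exp_ad_perturb]).

Suppose that g = exp(ad chi) f agrees with p up to order m.  Because chi has
degree 0, ad chi is a derivation of the bracket of series, so exp(ad chi) is
an automorphism ([sbracket_exp_ad]) and {g, g} = exp(ad chi) {f, f} = 0.  The
coefficient of nu^(m+1) in this equation is 2 {p, g_(m+1)} = 0
([leading_coef_cocycle]), where the two terms add up instead of cancelling
because p is odd.  So g_(m+1) is a cocycle of degree deg p, and the vanishing
of the cohomology gives y of degree 0 with {p, y} = g_(m+1).  Adding y to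
chi_(m+1) keeps the coefficients up to order m and changes the next one by
{y, p} = - {p, y}, which kills it ([gauge_extension]).  Each coefficient of
chi is modified at a single stage, so the successive corrections define a
series, and this series gauges f to p at all orders. *)

Set Implicit Arguments.
Unset Strict Implicit.
Unset Printing Implicit Defensive.

(** * Convolution sums *)

Section Antidiagonals.
Variable U : zmodType.

(** Summing over a full square, with the constraint carried by a multiplicity 0
or 1, removes the dependency of the summation bounds on outer indices; nested
convolutions can then be reordered by [exchange_big] alone. *)
Lemma sum_antidiagonal (F : nat -> nat -> U) M m : (m < M)%N ->
  \sum_(i < m.+1) F i (m - i)%N =
  \sum_(i < M) \sum_(j < M) F i j *+ (i + j == m)%N.
Proof.
move=> mM; rewrite (big_ord_widen M (fun i => F i (m - i)%N) mM) big_mkcond.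
apply: eq_bigr => i _; case: ltnP => im; last first.
  by rewrite big1 // => j _; case: eqP => // ijm; lia.
have jM : (m - i < M)%N by lia.
rewrite (bigD1 (Ordinal jM)) //= big1 ?addr0 => [|j /eqP ji].
  by rewrite subnKC // eqxx.
by case: eqP => // ijm; case: ji; apply: val_inj => /=; lia.
Qed.

(** This eliminates the intermediate degree l of a nested convolution.
If s >= M > m, both sides vanish. *)
Lemma sum_delta (x : U) M s i m : (m < M)%N ->
  \sum_(l < M) x *+ (s == l :> nat) *+ (i + l == m)%N = x *+ (i + s == m)%N.
Proof.
move=> mM; have [sM|Ms] := ltnP s M.
  rewrite (bigD1 (Ordinal sM)) //= eqxx big1 ?addr0 // => l /eqP ls.
  by case: eqP => [e|]; rewrite ?mul0rn //; case: ls; apply: val_inj.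
rewrite big1 => [|l _]; first by case: eqP => // e; lia.
by case: eqP => [e|]; rewrite ?mul0rn //; have := ltn_ord l; lia.
Qed.

End Antidiagonals.

(** * The bracket of formal series *)

Section SeriesBracket.
Variables (n : nat) (K : fieldType) (V : gradedLieType n K).
Implicit Types (f g h chi : nat -> V) (a b c : 'rV[int]_n).

Lemma sbracket_bilinear : bilinear_for *:%R *:%R (@sbracket n K V).
Proof.
split=> [g k f f'|f k g g']; apply/funext => m.
  rewrite -[RHS]/(k *: sbracket f g m + sbracket f' g m).
  rewrite scaler_sumr -big_split /=; apply: eq_bigr => i _.
  by rewrite linearPl.
rewrite -[RHS]/(k *: sbracket f g m + sbracket f g' m).
rewrite scaler_sumr -big_split /=; apply: eq_bigr => i _.
by rewrite linearPr.
Qed.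

HB.instance Definition _ :=
  bilinear_isBilinear.Build K (nat -> V) (nat -> V) (nat -> V) *:%R *:%R
    (@sbracket n K V) sbracket_bilinear.

Lemma sbracket_box f g M m : (m < M)%N ->
  sbracket f g m =
  \sum_(i < M) \sum_(j < M) bracket (f i) (g j) *+ (i + j == m)%N.
Proof.
by move=> mM; exact: (sum_antidiagonal (fun i j => bracket (f i) (g j))).
Qed.

Lemma sbracket_nestr_box f g h M m : (m < M)%N ->
  sbracket f (sbracket g h) m =
  \sum_(i < M) \sum_(j < M) \sum_(k < M)
    bracket (f i) (bracket (g j) (h k)) *+ (i + (j + k) == m)%N.
Proof.
move=> mM; rewrite (sbracket_box _ _ mM); apply: eq_bigr => i _.
under eq_bigr => l _.
  rewrite (sbracket_box _ _ (ltn_ord l)) linear_sumr -sumrMnl.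
  under eq_bigr => j _.
    rewrite linear_sumr -sumrMnl.
    under eq_bigr do rewrite linearMnr.
    over.
  over.
rewrite exchange_big; apply: eq_bigr => j _.
rewrite exchange_big; apply: eq_bigr => k _.
by rewrite sum_delta.
Qed.

Lemma sbracket_nestl_box f g h M m : (m < M)%N ->
  sbracket (sbracket f g) h m =
  \sum_(i < M) \sum_(j < M) \sum_(k < M)
    bracket (bracket (f i) (g j)) (h k) *+ (i + (j + k) == m)%N.
Proof.
move=> mM; rewrite (sbracket_box _ _ mM) exchange_big /=.
under eq_bigr => k _.
  under eq_bigr => l _.
    rewrite (sbracket_box _ _ (ltn_ord l)) linear_sumlz -sumrMnl.
    under eq_bigr => i _.
      rewrite linear_sumlz -sumrMnl.
      under eq_bigr do rewrite linearMnl.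
      over.
    over.
  rewrite exchange_big.
  over.
rewrite exchange_big; apply: eq_bigr => i _ /=.
under eq_bigr do rewrite exchange_big /=.
rewrite exchange_big; apply: eq_bigr => j _ /=.
apply: eq_bigr => k _.
under eq_bigr => l _ do rewrite [(l + k)%N]addnC.
by rewrite sum_delta // addnC addnA.
Qed.

Lemma dot0l a : dot 0 a = 0.
Proof. by rewrite /dot big1 // => i _; rewrite mxE mul0r. Qed.

(** This is the Jacobi identity taken coefficientwise; degree 0 of f makes its
sign trivial, as <0, a> = 0. *)
Lemma sbracket_derivation a b f g h :
  hseries 0 f -> hseries a g -> hseries b h ->
  sbracket f (sbracket g h) =
  sbracket (sbracket f g) h + sbracket g (sbracket f h).
Proof.
move=> f0 ga hb; apply/funext => m.
rewrite -[RHS]/(sbracket (sbracket f g) h m + sbracket g (sbracket f h) m).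
rewrite !(@sbracket_nestr_box _ _ _ m.+1) // (@sbracket_nestl_box _ _ _ m.+1) //.
rewrite [X in _ = _ + X]exchange_big -big_split; apply: eq_bigr => i _ /=.
rewrite -big_split; apply: eq_bigr => j _ /=.
rewrite -big_split; apply: eq_bigr => k _ /=.
rewrite (bracket_jacobi _ _ _ _ _ _ (f0 i) (ga j) (hb k)) dot0l scale1r mulrnDl.
by rewrite [(j + (i + k))%N]addnCA.
Qed.

Lemma hcompZ a (k : K) (x : V) : hcomp a x -> hcomp a (k *: x).
Proof.
by move=> ax; rewrite -[k *: x]addr0; apply: hcomp_linear => //; exact: hcomp0.
Qed.

Lemma hcompD a (x y : V) : hcomp a x -> hcomp a y -> hcomp a (x + y).
Proof. by move=> ax ay; rewrite -[x]scale1r; exact: hcomp_linear. Qed.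

Lemma hcomp_sum a I (r : seq I) (P : pred I) (F : I -> V) :
  (forall i, hcomp a (F i)) -> hcomp a (\sum_(i <- r | P i) F i).
Proof.
by move=> aF; apply: big_ind => //; [exact: hcomp0 | move=> x y; exact: hcompD].
Qed.

Lemma hseries_sbracket a b f g :
  hseries a f -> hseries b g -> hseries (a + b) (sbracket f g).
Proof. by move=> af bg m; apply: hcomp_sum => i; exact: bracket_hcomp. Qed.

End SeriesBracket.

(** * The exponential of ad chi *)

Section Exponential.
Variables (n : nat) (K : fieldType) (V : gradedLieType n K).
Implicit Types (f g chi : nat -> V) (a b : 'rV[int]_n).

Definition exp_term chi f (k : nat) : nat -> V :=
  (k`!%:R^-1 : K) *: iter k (sbracket chi) f.

(** Truncating after the power m loses nothing at order m when chi has no constant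
term, see [exp_ad_partial]. *)
Definition exp_ad chi f : nat -> V :=
  fun m => \sum_(k < m.+1) exp_term chi f k m.

(** Bracketing with a multiple of nu raises the nu-adic valuation by one. *)
Lemma iter_sbracket_low chi f k m : chi 0%N = 0 -> (m < k)%N ->
  iter k (sbracket chi) f m = 0.
Proof.
move=> chi0; elim: k m => // k IH m mk; rewrite iterS /sbracket big1 // => i _.
have [->|i0] := posnP i; first by rewrite chi0 linear0l.
by rewrite IH ?linear0r //; have := ltn_ord i; lia.
Qed.

Lemma exp_term_low chi f k m : chi 0%N = 0 -> (m < k)%N ->
  exp_term chi f k m = 0.
Proof.
move=> chi0 mk; rewrite -[LHS]/(_ *: iter k (sbracket chi) f m).
by rewrite iter_sbracket_low // scaler0.
Qed.

Lemma exp_ad_partial chi f m M : chi 0%N = 0 -> (m < M)%N ->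
  \sum_(k < M) exp_term chi f k m = exp_ad chi f m.
Proof.
move=> chi0 mM; rewrite /exp_ad (big_ord_widen M (fun k => exp_term chi f k m) mM).
rewrite [RHS]big_mkcond; apply: eq_bigr => k _; case: ltnP => // mk.
by rewrite exp_term_low.
Qed.

Lemma is_exp_ad_exp_ad chi f : chi 0%N = 0 -> is_exp_ad chi f (exp_ad chi f).
Proof.
by move=> chi0 m; exists m.+1 => N mN; rewrite fct_sumE -(@exp_ad_partial _ _ _ N).
Qed.

Lemma hseries_exp_term a chi f k : hseries 0 chi -> hseries a f ->
  hseries a (exp_term chi f k).
Proof.
move=> chi0 fa m; apply: hcompZ; elim: k m => // k IH m.
by rewrite iterS -[a]add0r; exact: hseries_sbracket.
Qed.

Lemma hseries_exp_ad a chi f : hseries 0 chi -> hseries a f ->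
  hseries a (exp_ad chi f).
Proof. by move=> chi0 fa m; apply: hcomp_sum => k; exact: hseries_exp_term. Qed.

Hypothesis charK : [pchar K] =i pred0.

Lemma natS_neq0 k : (k.+1%:R : K) != 0.
Proof. by rewrite (pcharf0P K).1. Qed.

Lemma sbracket_exp_term chi f k :
  sbracket chi (exp_term chi f k) = (k.+1%:R : K) *: exp_term chi f k.+1.
Proof.
rewrite /exp_term linearZr_LR scalerA factS natrM invfM mulrA.
by rewrite divff ?natS_neq0 // mul1r.
Qed.

(** The Leibniz formula for the divided powers D^k / k! of the derivation
D = ad chi.  If w_k denotes the left-hand side, then D w_k = (k+1) w_(k+1)
because D shifts the divided powers in the same way, and w_0 = {f, g}; division
by k+1 concludes the induction. *)
Lemma exp_term_sbracket a b chi f g k :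
  hseries 0 chi -> hseries a f -> hseries b g ->
  \sum_(i < k.+1) sbracket (exp_term chi f i) (exp_term chi g (k - i)) =
  exp_term chi (sbracket f g) k.
Proof.
move=> chi0 fa gb; elim: k => [|k IH].
  by rewrite big_ord1 /exp_term /= fact0 invr1 !scale1r.
apply: (scalerI (natS_neq0 k)); rewrite -sbracket_exp_term -IH linear_sumr /=.
under [RHS]eq_bigr => i _.
  rewrite (sbracket_derivation chi0 (hseries_exp_term _ chi0 fa)
    (hseries_exp_term _ chi0 gb)) !sbracket_exp_term linearZl_LR
    [sbracket _ (_.+1%:R *: _)]linearZr_LR.
  over.
rewrite big_split /=.
(* Both halves are reindexed to the antidiagonal of order k+1; the summand added
   by each shift has coefficient 0, and the weights i and k+1-i add up to k+1. *)
have -> : \sum_(i < k.+1) (i.+1%:R : K) *: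
      sbracket (exp_term chi f i.+1) (exp_term chi g (k - i)) =
    \sum_(i < k.+2) (i%:R : K) *:
      sbracket (exp_term chi f i) (exp_term chi g (k.+1 - i)).
  by rewrite [RHS]big_ord_recl scale0r add0r.
have -> : \sum_(i < k.+1) ((k - i).+1%:R : K) *:
      sbracket (exp_term chi f i) (exp_term chi g (k - i).+1) =
    \sum_(i < k.+2) ((k.+1 - i)%:R : K) *:
      sbracket (exp_term chi f i) (exp_term chi g (k.+1 - i)).
  rewrite [RHS]big_ord_recr /= subnn scale0r addr0; apply: eq_bigr => i _.
  by rewrite subSn // -ltnS.
rewrite -big_split scaler_sumr; apply: eq_bigr => i _ /=.
by rewrite -scalerDl -natrD subnKC // -ltnS.
Qed.

(** The exponential of a derivation is an automorphism: at order m, group the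
products of terms D^k f / k! and D^l g / l! by s = k + l and apply the Leibniz
formula; the products with k + l > m have valuation above m. *)
Lemma sbracket_exp_ad a b chi f g :
  chi 0%N = 0 -> hseries 0 chi -> hseries a f -> hseries b g ->
  sbracket (exp_ad chi f) (exp_ad chi g) = exp_ad chi (sbracket f g).
Proof.
move=> chi0 chi_deg fa gb; apply/funext => m.
pose X k l := sbracket (exp_term chi f k) (exp_term chi g l) m.
have X_low k l : (m < k + l)%N -> X k l = 0.
  move=> mkl; rewrite /X /sbracket big1 // => i _.
  have [ik|ki] := ltnP i k; first by rewrite exp_term_low // linear0l.
  rewrite [exp_term chi g _ _]exp_term_low ?linear0r //.
  by have := ltn_ord i; lia.
transitivity (\sum_(k < m.+1) \sum_(l < m.+1) X k l).
  rewrite /X /sbracket.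
  under [RHS]eq_bigr do rewrite exchange_big.
  rewrite exchange_big; apply: eq_bigr => i _ /=.
  rewrite -(@exp_ad_partial _ _ _ m.+1) //.
  rewrite -(@exp_ad_partial _ _ (m - i) m.+1) //; last by lia.
  by rewrite linear_sumlz; apply: eq_bigr => k _; rewrite linear_sumr.
rewrite /exp_ad; under [RHS]eq_bigr => s _.
  rewrite -(exp_term_sbracket _ chi_deg fa gb) fct_sumE.
  rewrite (sum_antidiagonal X (ltn_ord s)).
  over.
rewrite [RHS]exchange_big; apply: eq_bigr => k _ /=.
rewrite [RHS]exchange_big; apply: eq_bigr => l _ /=.
have [klm|mkl] := ltnP (k + l) m.+1.
  rewrite (bigD1 (Ordinal klm)) //= eqxx big1 ?addr0 // => s /eqP sn.
  by case: eqP => // e; case: sn; apply: val_inj.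
by rewrite X_low // big1 // => s _; rewrite mul0rn.
Qed.

Lemma iter_sbracket_agree chi chi' f k m :
  (forall i, (i <= m)%N -> chi i = chi' i) ->
  iter k (sbracket chi) f m = iter k (sbracket chi') f m.
Proof.
elim: k m => // k IH m agree; rewrite !iterS /sbracket.
apply: eq_bigr => i _; rewrite agree; last by rewrite -ltnS.
by congr bracket; apply: IH => j jm; apply: agree; lia.
Qed.

Lemma exp_ad_agree chi chi' f m :
  (forall i, (i <= m)%N -> chi i = chi' i) -> exp_ad chi f m = exp_ad chi' f m.
Proof.
move=> agree; apply: eq_bigr => k _.
rewrite -[LHS]/(_ *: iter k (sbracket chi) f m).
by rewrite (iter_sbracket_agree f k agree).
Qed.

(** In the powers (ad chi)^k f with k >= 2 the coefficient chi_m meets the constant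
coefficient of (ad chi)^(k-1) f, which is zero; so it contributes to order m
only through the linear term k = 1. *)
Lemma exp_ad_perturb chi chi' f m : (0 < m)%N -> chi 0%N = 0 ->
  (forall i, (i < m)%N -> chi' i = chi i) ->
  exp_ad chi' f m = exp_ad chi f m + bracket (chi' m - chi m) (f 0%N).
Proof.
move=> m0 chi0 agree.
have chi'0 : chi' 0%N = 0 by rewrite agree.
pose k1 : 'I_m.+1 := Ordinal (m0 : (1 < m.+1)%N).
rewrite /exp_ad (bigD1 k1) //= [in RHS](bigD1 k1) //= addrAC; congr (_ + _).
  rewrite -[LHS]/(_ *: sbracket chi' f m).
  rewrite -[exp_term _ _ _ _]/(_ *: sbracket chi f m).
  rewrite invr1 !scale1r /sbracket !big_ord_recr /= subnn linearBl /=.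
  rewrite -addrA [bracket (chi m) _ + _]addrC subrK; congr (_ + _).
  by apply: eq_bigr => i _; rewrite agree.
apply: eq_bigr => -[[|[|k]] km] //= _.
congr (_ *: _).
pose h := iter k.+1 (sbracket chi) f; pose h' := iter k.+1 (sbracket chi') f.
have hh' i : (i < m)%N -> h' i = h i.
  by move=> im; apply: iter_sbracket_agree => j ji; apply: agree; lia.
(* The summand i = m vanishes since h and h' have no constant term, the summand
   i = 0 since chi has none; the others involve only indices below m. *)
rewrite -[LHS]/(sbracket chi' h' m) -[RHS]/(sbracket chi h m) /sbracket.
rewrite !big_ord_recr /= subnn.
rewrite [h' 0%N]iter_sbracket_low // [h 0%N]iter_sbracket_low //.
rewrite !linear0r !addr0; apply: eq_bigr => i _; rewrite agree //.
have [->|i0] := posnP i; first by rewrite chi0 !linear0l.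
by rewrite hh' //; have := ltn_ord i; lia.
Qed.

End Exponential.

(** * The obstruction and its removal *)

Section Obstruction.
Variables (n : nat) (K : fieldType) (V : gradedLieType n K).
Implicit Types (f g chi : nat -> V) (a d : 'rV[int]_n) (p : V).

Lemma cocycle_exact a d p (x : V) : (forall h : cohomology d p a, h = 0) ->
  hcomp a x -> bracket p x = 0 ->
  exists2 y : V, hcomp (a - d) y & bracket p y = x.
Proof.
move=> H0 ax px.
have zx : x \in is_cocycle p a by apply/asboolP.
suff : (Cocycle zx : cocycle p a) \in @is_coboundary n K V d p a.
  by move=> /asboolP.
rewrite -[Cocycle zx]subr0 Quotient.idealrBE.
by apply/eqP; rewrite [LHS]H0 [RHS]H0.
Qed.

Lemma sign_odd (z : int) : odd `|z|%N -> (-1 : K) ^ z = -1.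
Proof.
by case: z => k /= ok; rewrite /exprz -signr_odd /= ok expr1 ?invrN1.
Qed.

Lemma bracket_odd_self d (x y : V) : hcomp d x -> hcomp d y -> odd_degree d ->
  bracket x y = bracket y x.
Proof.
move=> dx dy od.
by rewrite (bracket_antisym _ _ _ _ dx dy) sign_odd // scaleN1r opprK.
Qed.

Lemma bracket_degree0 d (x y : V) : hcomp 0 x -> hcomp d y ->
  bracket x y = - bracket y x.
Proof.
by move=> dx dy; rewrite (bracket_antisym _ _ _ _ dx dy) dot0l scale1r.
Qed.

Hypothesis charK : [pchar K] =i pred0.

(** At order m+1 only the two extreme terms of {g, g} survive, and they are equal
because g_(m+1) and p have the same odd degree. *)
Lemma leading_coef_cocycle d p g m : odd_degree d -> hseries d g ->
  sbracket g g = 0 -> g 0%N = p ->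
  (forall i, (0 < i <= m)%N -> g i = 0) -> bracket p (g m.+1) = 0.
Proof.
move=> od gd gg g0 glow.
have := congr1 (fun h : nat -> V => h m.+1) gg.
rewrite /= /sbracket big_ord_recl big_ord_recr /= big1 => [|i _]; last first.
  by rewrite glow ?linear0l //= /bump /=; have := ltn_ord i; lia.
rewrite add0r subn0 subnn g0 (@bracket_odd_self d (g m.+1)) //; last by rewrite -g0.
rewrite -mulr2n -scaler_nat => /eqP; rewrite scaler_eq0.
by rewrite (negPf (natS_neq0 charK 1)) => /eqP.
Qed.

Definition add_coef chi m (y : V) : nat -> V :=
  fun i => if i == m then chi i + y else chi i.

Definition gauges_up_to p f m chi : Prop :=
  [/\ hseries 0 chi, chi 0%N = 0 &
    forall i, (i <= m)%N -> exp_ad chi f i = const_series p i].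

Lemma gauge_extension d p f m chi : canonical_element d p ->
  (forall h : cohomology d p d, h = 0) -> formal_deformation d p f ->
  gauges_up_to p f m chi ->
  exists y : V, gauges_up_to p f m.+1 (add_coef chi m.+1 y).
Proof.
move=> [pd od _] H0 [fd f0 ff] [chi_deg chi0 chiE].
have gd := hseries_exp_ad chi_deg fd.
have gg : sbracket (exp_ad chi f) (exp_ad chi f) = 0.
  rewrite (sbracket_exp_ad charK chi0 chi_deg fd fd) ff.
  apply/funext => i; rewrite /exp_ad big1 // => k _.
  rewrite -[LHS]/(_ *: iter k (sbracket chi) 0 i).
  suff -> : iter k (sbracket chi) 0 = 0 by rewrite scaler0.
  by elim: (nat_of_ord k) => // j IH; rewrite iterS IH linear0r.
have pg : bracket p (exp_ad chi f m.+1) = 0.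
  apply: (leading_coef_cocycle od gd gg); first by rewrite chiE.
  by move=> i /andP[i0 im]; rewrite chiE // /const_series; case: eqP i0 => // ->.
have [y y0 py] := cocycle_exact H0 (gd m.+1) pg.
rewrite subrr in y0; exists y.
have agree i : (i < m.+1)%N -> add_coef chi m.+1 y i = chi i.
  by rewrite /add_coef; case: eqP => // ->; rewrite ltnn.
split; first by move=> i; rewrite /add_coef; case: eqP => // _; exact: hcompD.
  by rewrite agree.
move=> i; rewrite leq_eqVlt => /predU1P[->|im]; last first.
  rewrite (exp_ad_agree (chi' := chi)) ?chiE // => j ji.
  by rewrite agree //; lia.
rewrite (exp_ad_perturb f (ltn0Sn m) chi0 agree) /add_coef eqxx
  [_ + y - _]addrAC subrr add0r.
by rewrite f0 (bracket_degree0 y0 pd) py subrr.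
Qed.

End Obstruction.

Unset Implicit Arguments.

Theorem proposition2 (n : nat) (hn : (0 < n)%N)
    (K : fieldType) (hK : [pchar K] =i pred0)
    (V : gradedLieType n K) (d : 'rV[int]_n) (p : V)
    (hp : canonical_element d p)
    (hH : forall h : cohomology d p d, h = 0)
    (f : nat -> V) (hf : formal_deformation d p f) :
  trivial_deformation p f.
Proof.
(* [choice] requires a total function, hence the junk value 0 at the pairs
   (m, chi) for which chi does not gauge f up to order m. *)
have step (q : nat * (nat -> V)) : exists y : V,
    gauges_up_to p f q.1 q.2 -> gauges_up_to p f q.1.+1 (add_coef q.2 q.1.+1 y).
  have [|nq] := pselect (gauges_up_to p f q.1 q.2).
    by move=> /(gauge_extension hK hp hH hf)[y]; exists y.
  by exists 0.
have [Y Yext] := choice step.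
pose C := fix C m : nat -> V :=
  if m is k.+1 then add_coef (C k) m (Y (k, C k)) else 0.
have C_gauge m : gauges_up_to p f m (C m).
  elim: m => [|m IH]; last exact: (Yext (m, C m)).
  split=> [i||i]; [exact: hcomp0 | by [] |].
  rewrite leqn0 => /eqP ->; rewrite /exp_ad big_ord1.
  rewrite -[LHS]/((0`!%:R^-1 : K) *: f 0%N) fact0 invr1 scale1r.
  by case: hf.
have C_stable i k : C (i + k)%N i = C i i.
  elim: k => [|k IH]; first by rewrite addn0.
  by rewrite addnS /= /add_coef; case: eqP => // e; lia.
(* The diagonal is the nu-adic limit of the C m: stage m changes only the
   coefficient of order m. *)
pose chi i := C i i.
have chi0 : chi 0%N = 0 by [].
exists chi; split=> // [i|]; first by have [C_deg _ _] := C_gauge i; exact: C_deg.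
move=> m; have [N0 N0E] := is_exp_ad_exp_ad f chi0 m.
exists N0 => N /N0E ->.
have [_ _ CE] := C_gauge m; rewrite -(CE m (leqnn m)).
by apply: exp_ad_agree => i im; rewrite /chi -(C_stable i (m - i)%N) subnKC.
Qed.
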